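(* In $\mathsf{HPAL}$, for every $\varphi\in\mathcal{L}^{\div}$: if $\neg\varphi$ is preserved, then $\varphi$ is successful. That is, if $\neg\varphi\to[\div\neg\neg\varphi]\neg\varphi$ is valid in the class of all Kripke models, then for every $a\in Ag$ the formula $\exists\neg\varphi\to[\div\varphi]\neg B_a\varphi$ is valid in the class of all Kripke models.
   Context: Language. $At$ is a countable set of atoms, $Ag$ a finite set of agents. The contraction language $\mathcal{L}^{\div}$ is given by $\varphi::=\top\mid p\mid\neg\varphi\mid\varphi\wedge\varphi\mid B_a\varphi\mid[\div\varphi]\varphi\mid\forall\varphi$ with $p\in At$, $a\in Ag$; $\exists\varphi:=\neg\forall\neg\varphi$; the other Boolean connectives are the usual abbreviations. Semantics. A Kripke model is $\mathcal{M}=(W,R,V)$ with $W\neq\emptyset$, $R_a\subseteq W\times W$ an arbitrary relation for each $a\in Ag$, $V:At\to\wp(W)$; $R_a(w)=\{v:(w,v)\in R_a\}$. Atoms and Booleans are standard; $\mathcal{M},w\vDash B_a\varphi$ iff $\mathcal{M},v\vDash\varphi$ for all $v\in R_a(w)$; $\mathcal{M},w\vDash\forall\varphi$ iff $\mathcal{M},v\vDash\varphi$ for all $v\in W$; $\mathcal{M},w\vDash[\div\varphi]\psi$ iff $\mathcal{M}^{\div\varphi},w\vDash\psi$, where $\mathcal{M}^{\div\varphi}=(W,R^{\div\varphi},V)$ with $R_a^{\div\varphi}(w)=R_a(w)\cup\{v\in W:\mathcal{M},v\vDash\neg\varphi\}$ if $\mathcal{M},w\vDash B_a\varphi$, and $R_a^{\div\varphi}(w)=R_a(w)$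 otherwise. A formula is valid in a class of models if it is true at every world of every model in the class. $\mathsf{HPAL}$ is the logic of contraction updates over the class of all Kripke models. A formula $\psi$ is preserved (in $\mathsf{HPAL}$) if $\psi\to[\div\neg\psi]\psi$ is valid in the class of all Kripke models. A formula $\varphi$ is successful (in $\mathsf{HPAL}$) if $\exists\neg\varphi\to[\div\varphi]\neg B_a\varphi$ is valid in the class of all Kripke models for all $a\in Ag$. *)

(* Defs.v *)
From mathcomp Require Import all_boot.

Set Implicit Arguments.
Unset Strict Implicit.
Unset Printing Implicit Defensive.

Inductive formula (At : countType) (Ag : finType) : Type :=
| Top
| Atom of At
| Neg of formula At Ag
| And of formula At Ag & formula At Ag
| Bel of Ag & formula At Ag
| Contr of formula At Ag & formula At Ag (* [Contr phi psi] is [÷phi]psi *)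
| All of formula At Ag.

Arguments Top {At Ag}.
Arguments Atom {At Ag} p.
Arguments Neg {At Ag} phi.
Arguments And {At Ag} phi psi.
Arguments Bel {At Ag} a phi.
Arguments Contr {At Ag} phi psi.
Arguments All {At Ag} phi.

Definition Imp (At : countType) (Ag : finType) (phi psi : formula At Ag) :=
  Neg (And phi (Neg psi)).

Definition Ex (At : countType) (Ag : finType) (phi : formula At Ag) :=
  Neg (All (Neg phi)).

Record model (At : countType) (Ag : finType) : Type := Model {
  world :> Type;
  world_inh : inhabited world;
  acc : Ag -> world -> world -> Prop;
  val : At -> world -> Prop
}.

(* Contraction by a set of worlds P; [sat] below instantiates P with the truth
   set of the contracted formula, so that [forall u, acc a w u -> P u] is then
   the truth of the corresponding belief formula at w. *)
Definition contract (At : countType) (Ag : finType) (M : model At Ag)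
    (P : M -> Prop) : model At Ag :=
  @Model At Ag M (world_inh M)
    (fun a w v => acc a w v \/ ((forall u, acc a w u -> P u) /\ ~ P v))
    (@val At Ag M).

Fixpoint sat (At : countType) (Ag : finType) (phi : formula At Ag)
    (M : model At Ag) (w : M) {struct phi} : Prop :=
  match phi with
  | Top => True
  | Atom p => val p w
  | Neg phi1 => ~ sat phi1 w
  | And phi1 phi2 => sat phi1 w /\ sat phi2 w
  | Bel a phi1 => forall v, acc a w v -> sat phi1 v
  | Contr phi1 phi2 => @sat At Ag phi2 (contract (@sat At Ag phi1 M)) w
  | All phi1 => forall v : M, sat phi1 v
  end.

Definition valid_in (At : countType) (Ag : finType)
    (C : model At Ag -> Prop) (phi : formula At Ag) : Prop :=
  forall M : model At Ag, C M -> forall w : M, sat phi w.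

Definition all_models (At : countType) (Ag : finType) (M : model At Ag) : Prop :=
  True.

Definition preserved (At : countType) (Ag : finType) (psi : formula At Ag) :=
  valid_in (@all_models At Ag) (Imp psi (Contr (Neg psi) psi)).

Definition successful (At : countType) (Ag : finType) (phi : formula At Ag) :=
  forall a : Ag, valid_in (@all_models At Ag)
    (Imp (Ex (Neg phi)) (Contr phi (Neg (Bel a phi)))).

(* Main.v *)
Require Import Defs.
From mathcomp Require Import all_boot.
From Stdlib Require Import Classical FunctionalExtensionality PropExtensionality.

(** By preservation, a world refuting [phi] still refutes it after contraction
    by [phi]. If the agent does not believe [phi] at [w], a world accessible
    from [w] and refuting [phi] remains accessible; otherwise the contraction
    makes every world refuting [phi] accessible from [w]. *)

(** An equality of predicates rather than a pointwise equivalence, so that it rewrites the argument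
    of [contract]. *)
Lemma sat_NegNeg (At : countType) (Ag : finType) (phi : formula At Ag)
    (M : model At Ag) : @sat At Ag (Neg (Neg phi)) M = @sat At Ag phi M.
Proof.
apply: functional_extensionality => w; apply: propositional_extensionality.
by split=> [/NNPP|phi_w /(_ phi_w)].
Qed.

(** Preservation of [Neg phi] concerns contraction by [Neg (Neg phi)], which has the truth set of
    [phi] and so gives the same model. *)
Lemma preserved_NegP (At : countType) (Ag : finType) (phi : formula At Ag)
    (M : model At Ag) (w : M) :
  preserved (Neg phi) -> ~ sat phi w ->
  ~ @sat At Ag phi (contract (@sat At Ag phi M)) w.
Proof.
move=> /(_ M I w) pres nphi_w phi'_w; apply: pres; split=> //.
change (~ ~ @sat At Ag phi (contract (@sat At Ag (Neg (Neg phi)) M)) w).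
by rewrite sat_NegNeg; apply.
Qed.

Theorem proposition6p1 (At : countType) (Ag : finType) (phi : formula At Ag) :
  preserved (Neg phi) -> successful phi.
Proof.
move=> pres a M _ w [ex_nphi nnB]; apply: nnB => B.
apply: ex_nphi => v nphi_v.
(* [B] is belief after contraction, whereas edges are added only if [phi] is believed at [w]
   beforehand. *)
have phi_acc u : acc a w u -> sat phi u.
  move=> wu; apply: NNPP => nphi_u.
  by apply: (preserved_NegP _ _ _ _ _ pres nphi_u); apply: B; left.
by apply: (preserved_NegP _ _ _ _ _ pres nphi_v); apply: B; right.
Qed.
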